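(* Consider the symmetric system in Fourier space $\widehat V_t+\big(i|\xi|A_S(\xi)+B_S(\xi)\big)\widehat V=0$, $\xi\in\mathbb{R}^d\setminus\{0\}$, $t\ge0$, obtained from a symbol symmetrizable system as in the context. Assume that there exists a compensating matrix symbol $K_S(\xi)$ for the triplet $(I,A_S,B_S)$ such that, for some positive smooth function $f(\xi)$, $\xi\neq0$, $$[K_S(\xi)A_S(\xi)]^s+B_S(\xi)\ge f(\xi)I_n .$$ Suppose also that $$\frac{|\xi|\,|K_S(\xi)|}{1+|\xi|^2}\le C,\qquad \frac{|K_S(\xi)B_S(\xi)^{1/2}|}{(1+|\xi|^2)^{1/2}f(\xi)^{1/2}}\le C$$ for all $\xi\in\mathbb{R}^d\setminus\{0\}$ and some uniform constant $C>0$. Then there are uniform constants $C,k>0$ such that all solutions $\widehat V=\widehat V(\xi,t)$ satisfy $$|\widehat V(\xi,t)|\le C\exp\Big(-\frac{k|\xi|^2f(\xi)}{1+|\xi|^2}\,t\Big)|\widehat V(\xi,0)|\qquad\text{for all }\xi\in\mathbb{R}^d\setminus\{0\},\ t\ge0 .$$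
   Context: Setting: $U_t+\sum_{0\le|\alpha|\le m}L^\alpha D^\alpha U=0$ is a linear system with constant real $n\times n$ matrices $L^\alpha$, $x\in\mathbb{R}^d$, $d\geq 2$. For $\xi\ne0$, $\omega=\xi/|\xi|$, put $A(\xi)=\sum_{|\alpha|\text{ odd}}|\xi|^{|\alpha|-1}(-1)^{(|\alpha|-1)/2}\omega^\alpha L^\alpha$ and $B(\xi)=\sum_{|\alpha|\text{ even}}|\xi|^{|\alpha|}(-1)^{|\alpha|/2}\omega^\alpha L^\alpha$. The system is symbol symmetrizable: there is $S\in C^\infty(\mathbb{R}^d\setminus\{0\};\mathbb{R}^{n\times n})$ with $S(\xi)$ symmetric positive definite, $S(\xi)A(\xi)$, $S(\xi)B(\xi)$ symmetric and $S(\xi)B(\xi)\ge0$ for all $\xi\neq0$. Then $A_S=S^{1/2}AS^{-1/2}$ and $B_S=S^{1/2}BS^{-1/2}$ are smooth, real symmetric on $\mathbb{R}^d\setminus\{0\}$, with $B_S\ge0$, and $\widehat V=S^{1/2}\widehat U$. A compensating matrix symbol for $(I,A_S,B_S)$ is a $K_S\in C^\infty(\mathbb{R}^d\setminus\{0\};\mathbb{R}^{n\times n})$ with $K_S(\xi)$ skew-symmetric and $[K_S(\xi)A_S(\xi)]^s+B_S(\xi)$ positive definite for all $\xi\ne0$. $[M]^s=\frac12(M+M^\top)$; $|\cdot|$ denotes the norm of vectors or matrices. ''Uniform'' means independent of $\xi$, $t$ and the solution. *)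

(* Defs.v *)
From HB Require Import structures.
From mathcomp Require Import all_boot all_order all_algebra.
From mathcomp Require Import complex.
From mathcomp Require Import all_classical all_reals all_analysis.

Set Implicit Arguments.
Unset Strict Implicit.
Unset Printing Implicit Defensive.

Import Order.TTheory GRing.Theory Num.Theory.
Import numFieldNormedType.Exports.

Local Open Scope classical_set_scope.
Local Open Scope ring_scope.

Section Norms.
Variable R : realType.

(* The library's norm on matrices and vectors is the sup norm of the entries,
   so the Euclidean norms and the induced operator norm are defined here. *)
Definition enorm n (x : 'cV[R]_n) : R := Num.sqrt (\sum_i x i 0 ^+ 2).

Definition cnorm n (z : 'cV[R[i]]_n) : R :=
  Num.sqrt (\sum_i (complex.Re (z i 0) ^+ 2 + complex.Im (z i 0) ^+ 2)).

Definition opnorm n (M : 'M[R]_n) : R :=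
  sup [set enorm (M *m x) | x in [set x : 'cV[R]_n | enorm x <= 1]].

End Norms.

Section RealMatrices.
Variables (R : realType) (n : nat).
Implicit Types M N P : 'M[R]_n.

Definition qform M (x : 'cV[R]_n) : R := (x^T *m M *m x) 0 0.

Definition posdefmx M := M^T = M /\ forall x : 'cV[R]_n, x != 0 -> 0 < qform M x.

Definition possemidefmx M := M^T = M /\ forall x : 'cV[R]_n, 0 <= qform M x.

Definition loewner_le M N := possemidefmx (N - M).

Definition sympart M : 'M[R]_n := 2^-1 *: (M + M^T).

(* The symmetric positive semidefinite square root: for M symmetric positive
   semidefinite there is exactly one such P; otherwise there is none and
   the value is 0. *)
Definition sqrtmx M : 'M[R]_n :=
  xget 0 [set P | possemidefmx P /\ P *m P = M].

End RealMatrices.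

Section Smoothness.
Variables (R : realType) (d : nat) (W : normedModType R).

(* C^k on an open set O, through iterated partial derivatives; the values of f
   outside O are irrelevant. *)
Fixpoint Ck_on (O : set 'cV[R]_d) (k : nat) (f : 'cV[R]_d -> W) : Prop :=
  (forall x, O x -> {for x, continuous f}) /\
  if k is k'.+1 then
    forall j : 'I_d,
      (forall x, O x -> derivable f x (delta_mx j 0)) /\
      Ck_on O k' ('D_(delta_mx j 0) f)
  else True.

Definition smooth_off0 (f : 'cV[R]_d -> W) : Prop :=
  forall k, Ck_on [set x | x != 0] k f.

End Smoothness.

Section Symbols.
Variables (R : realType) (n d m : nat).

(* Multi-indices with all components at most m; the sums below keep only those
   of order at most m. *)
Definition multi_index := {ffun 'I_d -> 'I_m.+1}.

Definition order (al : multi_index) : nat := (\sum_j al j)%N.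

Definition monomial (x : 'cV[R]_d) (al : multi_index) : R :=
  \prod_j x j 0 ^+ al j.

Definition direction (xi : 'cV[R]_d) : 'cV[R]_d := (enorm xi)^-1 *: xi.

Variable L : multi_index -> 'M[R]_n.

Definition symA (xi : 'cV[R]_d) : 'M[R]_n :=
  \sum_(al : multi_index | (order al <= m)%N && odd (order al))
    (enorm xi ^+ (order al).-1 * (-1) ^+ (order al).-1./2
       * monomial (direction xi) al) *: L al.

Definition symB (xi : 'cV[R]_d) : 'M[R]_n :=
  \sum_(al : multi_index | (order al <= m)%N && ~~ odd (order al))
    (enorm xi ^+ order al * (-1) ^+ (order al)./2
       * monomial (direction xi) al) *: L al.

Record symbol_symmetrizer (S : 'cV[R]_d -> 'M[R]_n) : Prop := SymbolSymmetrizer {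
  symmetrizer_smooth : smooth_off0 S;
  symmetrizer_posdef : forall xi, xi != 0 -> posdefmx (S xi);
  symmetrizer_symA : forall xi, xi != 0 ->
    (S xi *m symA xi)^T = S xi *m symA xi;
  symmetrizer_symB : forall xi, xi != 0 -> possemidefmx (S xi *m symB xi)
}.

Variable S : 'cV[R]_d -> 'M[R]_n.

Definition AS (xi : 'cV[R]_d) : 'M[R]_n :=
  sqrtmx (S xi) *m symA xi *m invmx (sqrtmx (S xi)).

Definition BS (xi : 'cV[R]_d) : 'M[R]_n :=
  sqrtmx (S xi) *m symB xi *m invmx (sqrtmx (S xi)).

End Symbols.

Section FourierSystem.
Variables (R : realType) (n d : nat).
Variables A B : 'cV[R]_d -> 'M[R]_n.

(* Compensating matrix symbol for the triplet (I, A, B). *)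
Record compensating_symbol (K : 'cV[R]_d -> 'M[R]_n) : Prop := CompensatingSymbol {
  compensating_smooth : smooth_off0 K;
  compensating_skew : forall xi, xi != 0 -> (K xi)^T = - K xi;
  compensating_posdef : forall xi, xi != 0 ->
    posdefmx (sympart (K xi *m A xi) + B xi)
}.

Definition toC p q (M : 'M[R]_(p, q)) : 'M[R[i]]_(p, q) :=
  map_mx (real_complex R) M.

(* V' = fourier_rhs xi V is V' + (i |xi| A(xi) + B(xi)) V = 0. *)
Definition fourier_rhs (xi : 'cV[R]_d) (v : 'cV[R[i]]_n) : 'cV[R[i]]_n :=
  - ((('i%C * (enorm xi)%:C%C) *: toC (A xi) + toC (B xi)) *m v).

Definition RePart (v : 'cV[R[i]]_n) : 'cV[R]_n := map_mx (@complex.Re R) v.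
Definition ImPart (v : 'cV[R[i]]_n) : 'cV[R]_n := map_mx (@complex.Im R) v.

(* For each xi != 0, V xi is continuous on [0, +oo[ and solves the equation
   for t > 0; the equation then also holds at t = 0 with the one-sided
   derivative.  The library has no normed R-module structure on R[i], hence the
   separate real and imaginary parts. *)
Definition fourier_solution (V : 'cV[R]_d -> R -> 'cV[R[i]]_n) : Prop :=
  forall xi, xi != 0 ->
    [/\ {within [set t | 0 <= t], continuous (fun t => RePart (V xi t))},
        {within [set t | 0 <= t], continuous (fun t => ImPart (V xi t))},
        forall t : R, 0 < t ->
          is_derive t 1 (fun s => RePart (V xi s))
                        (RePart (fourier_rhs xi (V xi t))) &
        forall t : R, 0 < t ->
          is_derive t 1 (fun s => ImPart (V xi s))
                        (ImPart (fourier_rhs xi (V xi t)))].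

End FourierSystem.

(* Main.v *)
(* Write V = x + i y with x, y real, r = |xi| and h = r^2 f / (1 + r^2).  Then
   |V|^2 has derivative -2 Q with Q = x^T B x + y^T B y, and the compensated
   term g = x^T K y satisfies
     (r / (1 + r^2)) g' <= - (h / 2) |V|^2 + (1 + C^2 / 2) Q.
   Hence E = |V|^2 + (1 + C^2)^-1 (r / (1 + r^2)) g is equivalent to |V|^2 and
   E' <= - (h / (3 (1 + C^2))) E.  The square roots of S and B exist by
   diagonalizing real symmetric matrices over R. *)
Require Import Defs.
From HB Require Import structures.
From mathcomp Require Import all_boot all_order all_algebra.
From mathcomp Require Import complex.
From mathcomp Require Import all_classical all_reals all_analysis.
From mathcomp Require Import ring lra.

Import Order.TTheory GRing.Theory Num.Theory.
Import numFieldNormedType.Exports.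

Local Open Scope ring_scope.

Set Implicit Arguments.
Unset Strict Implicit.
Unset Printing Implicit Defensive.

(** * Euclidean inner product, Cauchy-Schwarz, and the operator norm bound *)

Section Dot.
Variables (R : realType) (n : nat).
Implicit Types (x y z : 'cV[R]_n) (M : 'M[R]_n) (a : R).

Definition dot x y : R := (x^T *m y) 0 0.

Lemma dotE x y : dot x y = \sum_i x i 0 * y i 0.
Proof. by rewrite /dot mxE; apply: eq_bigr => i _; rewrite mxE. Qed.

Lemma dotC x y : dot x y = dot y x.
Proof. by rewrite !dotE; apply: eq_bigr => i _; rewrite mulrC. Qed.

Lemma dotDl x y z : dot (x + y) z = dot x z + dot y z.
Proof. by rewrite /dot linearD mulmxDl mxE. Qed.

Lemma dotDr x y z : dot z (x + y) = dot z x + dot z y.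
Proof. by rewrite /dot mulmxDr mxE. Qed.

Lemma dot0r x : dot x 0 = 0.
Proof. by rewrite /dot mulmx0 mxE. Qed.

Lemma dotNl x y : dot (- x) y = - dot x y.
Proof. by rewrite /dot linearN mulNmx mxE. Qed.

Lemma dotNr x y : dot x (- y) = - dot x y.
Proof. by rewrite /dot mulmxN mxE. Qed.

Lemma dotZl a x y : dot (a *: x) y = a * dot x y.
Proof. by rewrite /dot linearZ /= -scalemxAl mxE. Qed.

Lemma dotZr a x y : dot x (a *: y) = a * dot x y.
Proof. by rewrite dotC dotZl dotC. Qed.

Lemma dot_mull M x y : dot (M *m x) y = dot x (M^T *m y).
Proof. by rewrite /dot trmx_mul mulmxA. Qed.

Lemma qformE M x : qform M x = dot x (M *m x).
Proof. by rewrite /qform /dot mulmxA. Qed.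

Lemma dotxx_ge0 x : 0 <= dot x x.
Proof. by rewrite dotE; apply: sumr_ge0 => i _; rewrite -expr2 sqr_ge0. Qed.

Lemma dotxx_eq0 x : dot x x = 0 -> x = 0.
Proof.
move=> /eqP; rewrite dotE psumr_eq0; last by move=> i _; rewrite -expr2 sqr_ge0.
move=> /allP h; apply/colP => i; rewrite mxE; apply/eqP.
by have := h i (mem_index_enum _); rewrite /= -expr2 sqrf_eq0.
Qed.

Lemma sqr_enorm x : enorm x ^+ 2 = dot x x.
Proof.
rewrite /enorm sqr_sqrtr; first by rewrite dotE; apply: eq_bigr.
by apply: sumr_ge0 => i _; rewrite sqr_ge0.
Qed.

Lemma enorm_ge0 x : 0 <= enorm x.
Proof. exact: sqrtr_ge0. Qed.

Lemma enorm_eq0 x : enorm x = 0 -> x = 0.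
Proof. by move=> h; apply: dotxx_eq0; rewrite -sqr_enorm h expr0n. Qed.

Lemma enormZ a x : enorm (a *: x) = `|a| * enorm x.
Proof.
apply/eqP; rewrite -(@eqrXn2 _ 2) ?enorm_ge0 ?mulr_ge0 ?enorm_ge0 //.
by rewrite exprMn !sqr_enorm dotZl dotZr real_normK ?num_real // mulrA.
Qed.

(** Expanding |[dot y y *: x - dot x y *: y]|^2 >= 0 gives |y|^2 times the Gram determinant of x and
    y; for y = 0 both sides vanish. *)
Lemma CauchySchwarz_dot x y : `|dot x y| <= enorm x * enorm y.
Proof.
rewrite -(@ler_pXn2r _ 2) ?nnegrE ?mulr_ge0 ?enorm_ge0 //.
rewrite exprMn !sqr_enorm real_normK ?num_real //.
have := dotxx_ge0 (dot y y *: x - dot x y *: y).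
rewrite !(dotDl, dotDr, dotNl, dotNr, dotZl, dotZr) (dotC y x).
have [y0|y0] := eqVneq (dot y y) 0.
  by move=> _; rewrite (dotxx_eq0 y0) !dot0r expr0n mulr0.
have yp : 0 < dot y y by rewrite lt0r y0 dotxx_ge0.
rewrite (_ : _ + _ = dot y y * (dot x x * dot y y - dot x y ^+ 2)); last by ring.
by rewrite pmulr_rge0 // subr_ge0.
Qed.

Lemma enorm_mulmx M x : enorm (M *m x) <= opnorm M * enorm x.
Proof.
(* [ub_le_sup] needs the set defining [opnorm] to be bounded above; the Frobenius norm of [M] is a
   bound, by Cauchy-Schwarz on each row. *)
have bound y : enorm y <= 1 -> enorm (M *m y) <= Num.sqrt (\sum_i enorm (row i M)^T ^+ 2).
  move=> y1; rewrite /enorm ler_sqrt; last first.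
    by apply: sumr_ge0 => i _; rewrite sqr_ge0.
  apply: ler_sum => i _.
  have -> : (M *m y) i 0 = dot (row i M)^T y.
    by rewrite /dot trmxK -row_mul [RHS]mxE.
  rewrite -[X in X ^+ 2 <= _]/(dot _ _) -(real_normK (num_real (dot _ _))).
  rewrite ler_pXn2r ?nnegrE ?normr_ge0 ?enorm_ge0 //.
  apply: le_trans (CauchySchwarz_dot _ _) _.
  by rewrite ler_piMr ?enorm_ge0.
have [x0|x0] := eqVneq (enorm x) 0.
  by have h := enorm_eq0 x0; rewrite h mulmx0 -h x0 mulr0.
have xp : 0 < enorm x by rewrite lt0r x0 enorm_ge0.
rewrite -ler_pdivrMr //.
have -> : enorm (M *m x) / enorm x = enorm (M *m ((enorm x)^-1 *: x)).
  by rewrite -scalemxAr enormZ ger0_norm ?invr_ge0 ?enorm_ge0 // mulrC.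
apply: ub_le_sup.
  by exists (Num.sqrt (\sum_i enorm (row i M)^T ^+ 2)) => _ [y y1 <-]; exact: bound.
exists ((enorm x)^-1 *: x) => //=.
by rewrite enormZ ger0_norm ?invr_ge0 ?enorm_ge0 // mulVf.
Qed.

End Dot.

(** * Diagonalization and square roots of real symmetric matrices *)

Section SquareRoot.
Variables (R : realType) (n : nat).
Implicit Types (M P : 'M[R]_n).

(** The spectral theorem over R[i] applies to the complexified matrix, with real eigenvalues. Two
    real matrices similar over R[i] are similar through a real matrix, which gives an invertible,
    not necessarily orthogonal, [Q]. *)
Lemma symmetric_diagonalizable M : M^T = M ->
  exists2 Q : 'M[R]_n, Q \in unitmx & exists d : 'rV[R]_n, Q *m M = diag_mx d *m Q.
Proof.
move=> Msym; pose MC : 'M[R[i]]_n := map_mx (real_complex R) M.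
pose re p q (X : 'M[R[i]]_(p, q)) : 'M[R]_(p, q) := map_mx (@complex.Re R) X.
have reK p q (X : 'M[R[i]]_(p, q)) : X \is a mxOver Num.real ->
    map_mx (real_complex R) (re p q X) = X.
  move=> /mxOverP Xr; apply/matrixP => i j; rewrite !mxE RRe_real //; exact: Xr.
have MCr : MC \is a mxOver Num.real.
  by apply/mxOverP => i j; rewrite mxE complex_real.
have MCh : MC \is hermsymmx.
  apply: realsym_hermsym => //.
  by apply/is_hermitianmxP; rewrite expr0 scale1r map_mx_id // /MC map_trmx Msym.
have /orthomx_spectralP MCE := hermitian_normalmx MCh.
have dr := hermitian_spectral_diag_real MCh.
set Pc := spectralmx MC in MCE; set sp := spectral_diag MC in MCE dr.
have sim : similar_in unitmx MC (diag_mx sp).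
  exists Pc; first exact: spectral_unit.
  apply/similarP; first exact: spectral_unit.
  by rewrite {1}MCE !mulmxA mulmxV ?spectral_unit // mul1mx.
have dgr : diag_mx sp \is a mxOver Num.real.
  apply/mxOverP => i j; rewrite mxE; case: eqP => _; rewrite ?mulr0n ?rpred0 //.
  by rewrite mulr1n; apply/mxOverP.
have [Q /andP[Qr Qu] QE] := real_similar sim MCr dgr.
move/similarP: QE => /(_ Qu) QE.
exists (re _ _ Q); first by rewrite -(map_unitmx (real_complex R)) reK.
exists (re _ _ sp); apply: (@map_mx_inj _ _ (real_complex R)).
by rewrite !map_mxM map_diag_mx !reK.
Qed.

Lemma sqrtmx_exists M : possemidefmx M -> exists P, possemidefmx P /\ P *m P = M.
Proof.
case=> Msym Mge0; have [Q Qu [d QM]] := symmetric_diagonalizable Msym.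
(* Row i of [Q] is a left eigenvector, so the quadratic form at it is [d 0 i] times its squared
   norm, and that norm is nonzero because [Q] is invertible. *)
have d_ge0 i : 0 <= d 0 i.
  have : row i (Q *m M) = d 0 i *: row i Q by rewrite QM; apply/rowP => j; rewrite mul_diag_mx !mxE.
  rewrite row_mul => qM.
  have := Mge0 (row i Q)^T; rewrite /qform trmxK qM -scalemxAl mxE.
  have: 0 < (row i Q *m (row i Q)^T) 0 0.
    have := dotxx_ge0 (row i Q)^T; rewrite /dot trmxK le0r => /orP[/eqP h|//].
    have q0 : (row i Q)^T = 0 by apply: dotxx_eq0; rewrite /dot trmxK.
    have := row_free_unit Q; rewrite Qu => /row_freeP [B QB].
    have := congr1 (fun X => row i X) QB.
    rewrite row_mul -(trmxK (row i Q)) q0 trmx0 mul0mx => /rowP /(_ i).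
    by rewrite !mxE eqxx => /eqP; rewrite eq_sym oner_eq0.
  by move=> qp; rewrite pmulr_lge0.
(* Fourth roots are taken so that the square root [N *m N] is the square of a symmetric matrix,
   which makes it positive semidefinite at once. *)
pose e : 'rV[R]_n := \row_i Num.sqrt (Num.sqrt (d 0 i)).
pose E := diag_mx e; pose N := invmx Q *m E *m Q.
have E4 : E *m E *m (E *m E) = diag_mx d.
  rewrite !mulmx_diag; congr diag_mx; apply/rowP => i; rewrite !mxE.
  by rewrite -!expr2 sqr_sqrtr ?sqrtr_ge0 // sqr_sqrtr.
(* [Q Q^T] commutes with the eigenvalues, hence with any function of them;
   this replaces the choice of an orthogonal [Q]. *)
have DG : diag_mx d *m (Q *m Q^T) = (Q *m Q^T) *m diag_mx d.
  rewrite mulmxA -QM.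
  have := congr1 trmx QM; rewrite !trmx_mul Msym tr_diag_mx => h.
  by rewrite -mulmxA h mulmxA.
(* Entrywise, [DG] says (d_i - d_j) g_ij = 0: either g_ij = 0, or d_i = d_j and hence e_i = e_j. *)
have EG : E *m (Q *m Q^T) = (Q *m Q^T) *m E.
  apply/matrixP => i j; rewrite mul_diag_mx mul_mx_diag.
  move/matrixP/(_ i j): DG; rewrite mul_diag_mx mul_mx_diag.
  rewrite ![in X in X -> _]mxE ![in X in _ -> X = _]mxE.
  set g := \sum_(_ < _) _; rewrite mulrC => /eqP.
  rewrite -subr_eq0 -mulrBr mulf_eq0 => /orP[/eqP g0|].
    by rewrite [in RHS]mxE [in RHS]mxE -/g g0 mul0r mulr0.
  rewrite subr_eq0 => /eqP dij.
  by rewrite [in RHS]mxE [in RHS]mxE -/g mulrC /e !mxE dij.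
have QTu : Q^T \in unitmx by rewrite unitmx_tr.
(* Multiplying by [Q] on the left and [Q^T] on the right turns the symmetry of [N] into [EG]. *)
have Nsym : N^T = N.
  apply: (can_inj (mulKmx Qu)); apply: (can_inj (mulmxK QTu)).
  rewrite /N !trmx_mul tr_diag_mx -/E !mulmxA mulmxV // mul1mx.
  rewrite -[LHS]mulmxA -trmx_mul mulmxV // trmx1 mulmx1.
  by rewrite -[RHS]mulmxA EG.
have NN : N *m N = invmx Q *m (E *m E) *m Q.
  by rewrite /N !mulmxA mulmxK.
exists (N *m N); split; first split.
- by rewrite trmx_mul Nsym.
- move=> x; rewrite qformE -mulmxA -[X in dot _ (X *m _)]Nsym -dot_mull.
  exact: dotxx_ge0.
- have -> : M = invmx Q *m diag_mx d *m Q by rewrite -mulmxA -QM mulKmx.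
  by rewrite NN -E4 !mulmxA mulmxK.
Qed.

Lemma sqrtmxP M : possemidefmx M ->
  possemidefmx (sqrtmx M) /\ sqrtmx M *m sqrtmx M = M.
Proof. by move=> /sqrtmx_exists h; exact: (xgetPex 0 h). Qed.

End SquareRoot.

(** * Calculus of vector-valued functions, coordinate by coordinate *)

Section Derivatives.
Local Open Scope classical_set_scope.
Variables (R : realType) (n : nat).
Implicit Types (u w : R -> 'cV[R]_n) (t : R) (M : 'M[R]_n).

Lemma is_derive_coord v u (u' : 'cV[R]_n) t (i : 'I_n) :
  is_derive t v u u' -> is_derive t v (fun s => u s i 0) (u' i 0).
Proof.
case=> ud uE; split; first by have /derivable_mxP := ud; exact.
by rewrite -uE derive_mx // mxE.
Qed.

Lemma is_derive_dot u w (u' w' : 'cV[R]_n) t :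
  is_derive t 1 u u' -> is_derive t 1 w w' ->
  is_derive t 1 (fun s => dot (u s) (w s)) (dot u' (w t) + dot (u t) w').
Proof.
move=> du dw.
have -> : (fun s => dot (u s) (w s)) =
    \sum_(i < n) ((fun s => u s i 0) * (fun s => w s i 0)).
  by apply/funext => s; rewrite dotE fct_sumE.
rewrite !dotE -big_split /=; apply: is_derive_sum => i.
apply: is_derive_eq; first by apply: is_deriveM; exact: is_derive_coord.
by rewrite /= addrC [u' i 0 * _]mulrC.
Qed.

Lemma is_derive_mulmx M u (u' : 'cV[R]_n) t :
  is_derive t 1 u u' -> is_derive t 1 (fun s => M *m u s) (M *m u').
Proof.
move=> du; have dc i : is_derive t 1 (fun s => (M *m u s) i 0) ((M *m u') i 0).
  have E x : (M *m x) i 0 = dot (row i M)^T x.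
    by rewrite /dot trmxK -row_mul [RHS]mxE.
  under eq_fun do rewrite E.
  (* The null term is the derivative of the constant row, so that the product rule applies. *)
  rewrite E -[dot _ u']add0r -(_ : dot 0 (u t) = 0); last by rewrite dotC dot0r.
  exact: is_derive_dot.
have dM : derivable (fun s => M *m u s) t 1.
  by apply/derivable_mxP => i j; rewrite ord1; case: (dc i).
split=> //; rewrite derive_mx //; apply/colP => i.
by rewrite mxE; case: (dc i).
Qed.

Lemma continuous_within_bilinear (D : set R) M u w :
  {within D, continuous u} -> {within D, continuous w} ->
  {within D, continuous (fun s => dot (u s) (M *m w s))}.
Proof.
move=> cu cw.
have cD (v : R -> 'cV[R]_n) (i : 'I_n) : {within D, continuous v} ->
    {within D, continuous (fun s => v s i 0)}.
  move=> cv s; apply: (@continuous_comp (subspace D) _ _ v (fun x : 'cV[R]_n => x i 0)).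
    exact: cv.
  exact: coord_continuous.
have -> : (fun s => dot (u s) (M *m w s)) =
    (fun s => \sum_(i < n) (u s i 0 * \sum_(j < n) M i j * w s j 0)).
  by apply/funext => s; rewrite dotE; apply: eq_bigr => i _; rewrite mxE.
move=> s; apply: cvg_big => [|i _]; [exact: add_continuous|]; apply: cvgM; first exact: cD.
by apply: cvg_big => [|j _]; [exact: add_continuous|]; apply: cvgM; [exact: cvg_cst|exact: cD].
Qed.

End Derivatives.

(** * Symmetry and positivity of the conjugated symbols *)

Section SymmetrizedSymbols.
Variables (R : realType) (n : nat).
Implicit Types (S M : 'M[R]_n).

Lemma posdefmx_semi M : posdefmx M -> possemidefmx M.
Proof.
case=> Msym Mpos; split=> // x; have [->|x0] := eqVneq x 0; last exact/ltW/Mpos.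
by rewrite qformE mulmx0 dot0r.
Qed.

(** A row vector v with v S^{1/2} = 0 satisfies v S v^T = 0, so v = 0. *)
Lemma sqrtmx_unit S : posdefmx S -> sqrtmx S \in unitmx.
Proof.
move=> hS; have [_ PP] := sqrtmxP (posdefmx_semi hS).
rewrite -row_free_unit; apply: inj_row_free => v vP.
apply/eqP; apply: contraT => v0.
have := hS.2 v^T; rewrite trmx_eq0 => /(_ v0).
by rewrite /qform trmxK -PP mulmxA vP !mul0mx mxE ltxx.
Qed.

(** Conjugation by S^{1/2} is rewritten as a congruence of S M by the symmetric matrix S^{-1/2};
    symmetry and semidefiniteness of S M then carry over. *)
Lemma symmetrizedE S M : posdefmx S ->
  sqrtmx S *m M *m invmx (sqrtmx S) =
    invmx (sqrtmx S) *m (S *m M) *m invmx (sqrtmx S).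
Proof.
move=> hS; have [_ PP] := sqrtmxP (posdefmx_semi hS).
by rewrite -[X in _ *m (X *m M)]PP !mulmxA mulVmx ?sqrtmx_unit // mul1mx.
Qed.

Lemma symmetrized_sym S M : posdefmx S -> (S *m M)^T = S *m M ->
  (sqrtmx S *m M *m invmx (sqrtmx S))^T = sqrtmx S *m M *m invmx (sqrtmx S).
Proof.
move=> hS hM; have [[Psym _] _] := sqrtmxP (posdefmx_semi hS).
by rewrite symmetrizedE // !(trmx_mul (invmx _ *m _)) trmx_mul hM trmx_inv Psym mulmxA.
Qed.

Lemma symmetrized_psd S M : posdefmx S -> possemidefmx (S *m M) ->
  possemidefmx (sqrtmx S *m M *m invmx (sqrtmx S)).
Proof.
move=> hS [hM Mge0]; split; first exact: symmetrized_sym.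
move=> x; have [[Psym _] _] := sqrtmxP (posdefmx_semi hS).
rewrite symmetrizedE // qformE -!mulmxA -[X in dot _ (X *m _)]trmxK -dot_mull.
by rewrite trmx_inv Psym mulmxA -qformE.
Qed.

End SymmetrizedSymbols.

(** * Exponential decay from a differential inequality *)

Section Gronwall.
Variable R : realType.
Local Open Scope classical_set_scope.

(** With the integrating factor, e^{cs} E(s) has nonpositive derivative for s > 0; continuity up to
    0 extends the monotonicity to the closed half-line. *)
Lemma gronwall_decay (E E' : R -> R) (c t : R) :
  {within [set s : R | 0 <= s], continuous E} ->
  (forall s : R, 0 < s -> is_derive s 1 E (E' s)) ->
  (forall s : R, 0 < s -> E' s <= - c * E s) ->
  0 <= t -> E t <= expR (- c * t) * E 0.
Proof.
move=> Ec Ed Ele t0; pose F s := expR (c * s) * E s.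
have dF (s : R) : 0 < s -> is_derive s 1 F (expR (c * s) * (E' s + c * E s)).
  move=> s0; have dE := Ed s s0.
  have dexp : is_derive s 1 (fun s => expR (c * s)) (c * expR (c * s)).
    have dc : is_derive s 1 (fun s => c * s) c.
      by apply: is_derive_eq; rewrite /GRing.scale /= mulr1.
    have := @is_derive1_comp _ expR (fun s => c * s) s _ _ (is_derive_expR (c * s)) dc.
    by rewrite mulrC.
  have := @is_deriveM _ _ _ _ s 1 _ _ dexp dE.
  rewrite (_ : expR (c * s) *: _ + _ = expR (c * s) * (E' s + c * E s)) //.
  by rewrite /GRing.scale /=; ring.
suff : F t <= F 0.
  rewrite /F mulr0 expR0 mul1r => FE.
  by rewrite mulNr expRN ler_pdivlMl ?expR_gt0.
apply: (@ler0_derive1_nincry _ F 0) => // [s|s|].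
- by rewrite in_itv /= andbT => /dF [].
- rewrite in_itv /= andbT => s0; rewrite derive1E; have [_ ->] := dF s s0.
  rewrite pmulr_rle0 ?expR_gt0 //; have := Ele s s0; lra.
- rewrite (_ : mkset _ = [set s : R | 0 <= s]); last first.
    by apply/seteqP; split => s /=; rewrite in_itv /= andbT.
  move=> s; apply: cvgM; last exact: Ec.
  apply: (@continuous_subspaceT _ _ _ (fun s => expR (c * s))) => r.
  apply: continuous_comp; last exact: continuous_expR.
  exact: mulrl_continuous.
Qed.

End Gronwall.

(** * Real and imaginary parts of the Fourier system *)

Section FourierRhs.
Variables (R : realType) (n d : nat) (A B : 'cV[R]_d -> 'M[R]_n).

Lemma RePart_fourier_rhs xi v :
  RePart (fourier_rhs A B xi v) =
    enorm xi *: (A xi *m ImPart v) - B xi *m RePart v.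
Proof.
apply/colP => i; rewrite !mxE raddfN raddf_sum /= mulr_sumr -!sumrN -big_split /=.
apply: eq_bigr => j _; rewrite !mxE; case: (v j 0) => a b /=; ring.
Qed.

Lemma ImPart_fourier_rhs xi v :
  ImPart (fourier_rhs A B xi v) =
    - (enorm xi *: (A xi *m RePart v)) - B xi *m ImPart v.
Proof.
apply/colP => i; rewrite !mxE raddfN raddf_sum /= mulr_sumr -!sumrN -big_split /=.
apply: eq_bigr => j _; rewrite !mxE; case: (v j 0) => a b /=; ring.
Qed.

Lemma sqr_cnorm (v : 'cV[R[i]]_n) :
  cnorm v ^+ 2 = dot (RePart v) (RePart v) + dot (ImPart v) (ImPart v).
Proof.
rewrite sqr_sqrtr; last by apply: sumr_ge0 => i _; rewrite addr_ge0 ?sqr_ge0.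
by rewrite !dotE -big_split; apply: eq_bigr => i _ /=; rewrite !mxE !expr2.
Qed.

End FourierRhs.

(** * Energy estimate at one frequency, with [r] for |xi| and [P] for B^{1/2} *)

Section Energy.
Local Open Scope classical_set_scope.
Variables (R : realType) (n : nat) (A B K P : 'M[R]_n) (r f C : R).
Hypotheses (AT : A^T = A) (PT : P^T = P) (PP : P *m P = B) (KT : K^T = - K).
Hypotheses (r_ge0 : 0 <= r) (f_gt0 : 0 < f) (C_gt0 : 0 < C).
Hypothesis coercive : forall x : 'cV[R]_n,
  f * dot x x <= dot x (K *m (A *m x)) + dot x (B *m x).
Hypothesis K_le : r * opnorm K / (1 + r ^+ 2) <= C.
Hypothesis KP_le :
  opnorm (K *m P) / (Num.sqrt (1 + r ^+ 2) * Num.sqrt f) <= C.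
Implicit Types x y : 'cV[R]_n.

(** The weight [tau] makes the corrector bounded through [K_le], and [h] equals [tau * r * f], the
    coercivity left after weighting. *)
Let tau := r / (1 + r ^+ 2).
Let h := r ^+ 2 * f / (1 + r ^+ 2).
Let D_gt0 : 0 < 1 + r ^+ 2. Proof. by rewrite ltr_wpDr ?sqr_ge0. Qed.
Let tau_ge0 : 0 <= tau. Proof. by rewrite divr_ge0 // ltW. Qed.

Lemma dot_dissipation x : dot x (B *m x) = dot (P *m x) (P *m x).
Proof. by rewrite dot_mull PT mulmxA PP. Qed.

Lemma corrector_bound x y :
  `|tau * dot x (K *m y)| <= C / 2 * (dot x x + dot y y).
Proof.
rewrite normrM ger0_norm // -!sqr_enorm.
have h1 := CauchySchwarz_dot x (K *m y); have h2 := enorm_mulmx K y.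
have x0 := enorm_ge0 x; have y0 := enorm_ge0 y.
have h3 : `|dot x (K *m y)| <= opnorm K * (enorm x * enorm y).
  by apply: le_trans h1 _; rewrite mulrCA ler_wpM2l.
apply: le_trans (ler_wpM2l tau_ge0 h3) _.
rewrite [tau * (_ * _)]mulrA (_ : tau * opnorm K = r * opnorm K / (1 + r ^+ 2)); last first.
  by rewrite /tau mulrAC.
apply: le_trans (ler_wpM2r (mulr_ge0 x0 y0) K_le) _.
rewrite -mulrA ler_wpM2l ?(ltW C_gt0) //.
by have := sqr_ge0 (enorm x - enorm y); lra.
Qed.

(** Writing B = P P leaves one factor P on y and lets [KP_le] bound K P. The weights combine as tau
    sqrt(1 + r^2) sqrt(f) |x| = sqrt(h |x|^2). *)
Lemma dissipation_cross_bound x y :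
  tau * `|dot x (K *m (B *m y))| <=
    C * Num.sqrt (h * dot x x) * enorm (P *m y).
Proof.
have -> : dot x (K *m (B *m y)) = dot x (K *m P *m (P *m y)).
  by rewrite -PP !mulmxA.
have h1 := CauchySchwarz_dot x (K *m P *m (P *m y)).
have h2 := enorm_mulmx (K *m P) (P *m y).
have x0 := enorm_ge0 x; have y0 := enorm_ge0 (P *m y).
have sD : 0 < Num.sqrt (1 + r ^+ 2) by rewrite sqrtr_gt0.
have sf : 0 < Num.sqrt f by rewrite sqrtr_gt0.
have KP : opnorm (K *m P) <= C * (Num.sqrt (1 + r ^+ 2) * Num.sqrt f).
  by rewrite -ler_pdivrMr // mulr_gt0.
have E : tau * Num.sqrt (1 + r ^+ 2) * Num.sqrt f * enorm x = Num.sqrt (h * dot x x).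
  have -> : h * dot x x = (r * Num.sqrt f * enorm x / Num.sqrt (1 + r ^+ 2)) ^+ 2.
    by rewrite !exprMn exprVn sqr_enorm !sqr_sqrtr ?(ltW D_gt0) ?(ltW f_gt0) // /h; ring.
  rewrite sqrtr_sqr ger0_norm; last by rewrite !mulr_ge0 ?invr_ge0 // ltW.
  rewrite /tau -{1}(sqr_sqrtr (ltW D_gt0)); field.
  by rewrite lt0r_neq0.
rewrite -E.
apply: le_trans (ler_wpM2l tau_ge0 (le_trans h1 (ler_wpM2l x0 h2))) _.
apply: le_trans (ler_wpM2l tau_ge0 (ler_wpM2l x0 (ler_wpM2r y0 KP))) _.
by rewrite le_eqVlt; apply/orP; left; apply/eqP; ring.
Qed.

Let dx x y := r *: (A *m y) - B *m x.
Let dy x y := - (r *: (A *m x)) - B *m y.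

(** The terms in [r] cancel because A is symmetric; only the dissipation remains. *)
Lemma norm_derivative x y :
  dot (dx x y) x + dot x (dx x y) + (dot (dy x y) y + dot y (dy x y)) =
    - 2 * (dot x (B *m x) + dot y (B *m y)).
Proof.
rewrite (dotC (dx x y)) (dotC (dy x y)) !(dotDr, dotNr, dotZr).
rewrite (dotC y (A *m x)) dot_mull AT; ring.
Qed.

(** Skewness of K moves the derivative of x to the right of K, so both terms in [r] have the form K
    A with the same sign, as coercivity requires. *)
Lemma corrector_derivative x y :
  dot (dx x y) (K *m y) + dot x (K *m dy x y) =
    - r * (dot x (K *m (A *m x)) + dot y (K *m (A *m y)))
    + dot y (K *m (B *m x)) - dot x (K *m (B *m y)).
Proof.
have sk u v : dot u (K *m v) = - dot v (K *m u).
  by rewrite dotC dot_mull KT mulNmx dotNr.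
rewrite (sk (dx x y)) !(mulmxDr, mulmxN) -!scalemxAr !(dotDr, dotNr, dotZr).
ring.
Qed.

(** Coercivity times tau r gives -h |V|^2 + tau r Q with tau r <= 1. The two cross terms cost (h /
    2) |V|^2 + (C^2 / 2) Q, which leaves half of the decay. *)
Lemma corrector_derivative_le x y :
  tau * (dot (dx x y) (K *m y) + dot x (K *m dy x y)) <=
    - (h / 2) * (dot x x + dot y y)
    + (1 + C ^+ 2 / 2) * (dot x (B *m x) + dot y (B *m y)).
Proof.
rewrite corrector_derivative.
have h_ge0 : 0 <= h by rewrite /h !mulr_ge0 ?invr_ge0 ?sqr_ge0 // ltW.
have tr1 : tau * r <= 1.
  by rewrite /tau mulrAC ler_pdivrMr // mul1r -expr2 lerDr.
have tr0 : 0 <= tau * r by rewrite mulr_ge0.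
have trf : tau * r * f = h by rewrite /tau /h; ring.
have c1 := ler_wpM2l tr0 (coercive x); have c2 := ler_wpM2l tr0 (coercive y).
have Qx : 0 <= dot x (B *m x) by rewrite dot_dissipation dotxx_ge0.
have Qy : 0 <= dot y (B *m y) by rewrite dot_dissipation dotxx_ge0.
have qx := ler_wpM2r Qx tr1; have qy := ler_wpM2r Qy tr1.
(* AM-GM: [C sqrt(h |x|^2) |P y| <= h |x|^2 / 2 + C^2 |P y|^2 / 2] *)
have am u v : tau * `|dot u (K *m (B *m v))| <=
    h / 2 * dot u u + C ^+ 2 / 2 * dot v (B *m v).
  apply: le_trans (dissipation_cross_bound u v) _.
  rewrite dot_dissipation -(sqr_enorm (P *m v)).
  have := sqr_ge0 (Num.sqrt (h * dot u u) - C * enorm (P *m v)).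
  have := sqr_sqrtr (mulr_ge0 h_ge0 (dotxx_ge0 u)).
  set s := Num.sqrt _; set p := enorm _; move: (dot u u) => w E.
  rewrite (_ : (s - C * p) ^+ 2 = s ^+ 2 - 2 * (C * s * p) + C ^+ 2 * p ^+ 2); last by ring.
  rewrite E; lra.
have a1 := am y x; have a2 := am x y.
have b1 := ler_wpM2l tau_ge0 (ler_norm (dot y (K *m (B *m x)))).
have b2 := ler_wpM2l tau_ge0 (ler_norm (- dot x (K *m (B *m y)))).
rewrite normrN in b2.
rewrite !mulrA trf !mulrDr in c1 c2.
lra.
Qed.

(** This size serves twice: delta C <= 1 keeps the corrector below half of |V|^2, and delta (1 +
    C^2) = 1 lets the dissipation absorb the Q terms. *)
Let delta := (1 + C ^+ 2)^-1.

Lemma energy_decay (x y : R -> 'cV[R]_n) (t : R) :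
  {within [set s : R | 0 <= s], continuous x} ->
  {within [set s : R | 0 <= s], continuous y} ->
  (forall s : R, 0 < s -> is_derive s 1 x (dx (x s) (y s))) ->
  (forall s : R, 0 < s -> is_derive s 1 y (dy (x s) (y s))) ->
  0 <= t ->
  dot (x t) (x t) + dot (y t) (y t) <=
    3 * expR (- (delta * h / 3) * t) * (dot (x 0) (x 0) + dot (y 0) (y 0)).
Proof.
move=> cx cy dxE dyE t0.
have CC : 0 < 1 + C ^+ 2 by rewrite ltr_wpDr ?sqr_ge0.
have d0 : 0 < delta by rewrite invr_gt0.
have dC : delta * (1 + C ^+ 2) = 1 by rewrite mulVf // lt0r_neq0.
have dC1 : delta * C <= 1.
  rewrite -dC ler_wpM2l ?(ltW d0) //; have := sqr_ge0 (C - 1).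
  by rewrite (_ : (C - 1) ^+ 2 = C ^+ 2 - 2 * C + 1); [lra|ring].
have h_ge0 : 0 <= h by rewrite /h !mulr_ge0 ?invr_ge0 ?sqr_ge0 // ltW.
pose N s := dot (x s) (x s) + dot (y s) (y s).
pose g s := dot (x s) (K *m y s).
have N0 s : 0 <= N s by rewrite addr_ge0 ?dotxx_ge0.
pose E s := N s + delta * tau * g s.
have gN s : `|delta * tau * g s| <= N s / 2.
  rewrite -mulrA normrM (ger0_norm (ltW d0)).
  apply: le_trans (ler_wpM2l (ltW d0) (corrector_bound _ _)) _.
  by have := ler_wpM2r (N0 s) dC1; rewrite -/(N s); lra.
have EN s : N s / 2 <= E s <= 3 / 2 * N s.
  by have := gN s; rewrite ler_norml => /andP[? ?]; apply/andP; split; rewrite /E; lra.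
pose E' s := dot (dx (x s) (y s)) (x s) + dot (x s) (dx (x s) (y s))
   + (dot (dy (x s) (y s)) (y s) + dot (y s) (dy (x s) (y s)))
   + delta * tau * (dot (dx (x s) (y s)) (K *m y s) + dot (x s) (K *m dy (x s) (y s))).
have dE (s : R) : 0 < s -> is_derive s 1 E (E' s).
  move=> s0; have dxs := dxE _ s0; have dys := dyE _ s0.
  have dKy := is_derive_mulmx K dys.
  have dg := is_derive_dot dxs dKy.
  have dN := is_deriveD (is_derive_dot dxs dxs) (is_derive_dot dys dys).
  exact: (is_deriveD dN (is_deriveZ (delta * tau) dg)).
have cE : {within [set s : R | 0 <= s], continuous E}.
  have cdot (u : R -> 'cV[R]_n) : {within [set s : R | 0 <= s], continuous u} ->
      {within [set s : R | 0 <= s], continuous (fun s => dot (u s) (u s))}.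
    (* The identity matrix is inserted to reuse the continuity of bilinear forms. *)
    move=> cu; rewrite (_ : (fun s => _) = (fun s => dot (u s) (1%:M *m u s))).
      exact: continuous_within_bilinear.
    by apply/funext => s; rewrite mul1mx.
  move=> s; apply: cvgD; first by apply: cvgD; exact: cdot.
  apply: cvgM; first exact: cvg_cst.
  exact: continuous_within_bilinear.
(* Here E' <= -2 Q - (delta h / 2) N + delta (1 + C^2 / 2) Q. The Q terms sum to at most 0, and E <=
   (3 / 2) N converts N into E, whence the rate delta h / 3. *)
have E'_le (s : R) : 0 < s -> E' s <= - (delta * h / 3) * E s.
  move=> s0; rewrite /E' norm_derivative.
  have := ler_wpM2l (ltW d0) (corrector_derivative_le (x s) (y s)).
  rewrite mulrA -/(N s); set G := dot _ _ + dot _ _.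
  have : 0 <= dot (x s) (B *m x s) + dot (y s) (B *m y s).
    by rewrite !dot_dissipation addr_ge0 ?dotxx_ge0.
  move: (dot (x s) (B *m x s) + _) => Q Q0 GN.
  have /andP[_ E3] := EN s.
  have := ler_wpM2l (mulr_ge0 (ltW d0) h_ge0) E3.
  have : 0 <= delta * C ^+ 2 * Q by rewrite !mulr_ge0 ?sqr_ge0 // ltW.
  have : delta * (1 + C ^+ 2) * Q = Q by rewrite dC mul1r.
  lra.
(* The factor 3 arises from N(t) <= 2 E(t) and E(0) <= (3 / 2) N(0). *)
have := gronwall_decay cE dE E'_le t0.
have /andP[Et _] := EN t; have /andP[_ E0] := EN 0.
have := ler_wpM2l (expR_ge0 (- (delta * h / 3) * t)) E0.
rewrite -/(N t) -/(N 0); lra.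
Qed.

End Energy.

(** * Pointwise decay with constants uniform in the frequency *)

Theorem lemma4p1 (R : realType) (n d m : nat) (hd : (2 <= d)%N)
    (L : multi_index d m -> 'M[R]_n)
    (S : 'cV[R]_d -> 'M[R]_n) (hS : symbol_symmetrizer L S)
    (KS : 'cV[R]_d -> 'M[R]_n)
    (hKS : compensating_symbol (AS L S) (BS L S) KS)
    (f : 'cV[R]_d -> R) (f_smooth : smooth_off0 f)
    (f_pos : forall xi, xi != 0 -> 0 < f xi)
    (hf : forall xi, xi != 0 ->
      loewner_le (f xi)%:M (sympart (KS xi *m AS L S xi) + BS L S xi))
    (hC : exists2 C : R, 0 < C & forall xi, xi != 0 ->
      enorm xi * opnorm (KS xi) / (1 + enorm xi ^+ 2) <= C /\
      opnorm (KS xi *m sqrtmx (BS L S xi))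
        / (Num.sqrt (1 + enorm xi ^+ 2) * Num.sqrt (f xi)) <= C) :
  exists C k : R, [/\ 0 < C, 0 < k &
    forall V : 'cV[R]_d -> R -> 'cV[R[i]]_n,
      fourier_solution (AS L S) (BS L S) V ->
      forall (xi : 'cV[R]_d) (t : R), xi != 0 -> 0 <= t ->
        cnorm (V xi t) <=
          C * expR (- (k * enorm xi ^+ 2 * f xi / (1 + enorm xi ^+ 2)) * t)
            * cnorm (V xi 0)].
Proof.
have [C C0 hKC] := hC.
(* The energy estimate concerns |V|^2: its rate factor delta / 3 is halved for |V|, and its factor 3
   is at most 2^2. *)
exists 2, ((1 + C ^+ 2)^-1 / 6); split => //.
  by rewrite divr_gt0 // invr_gt0 ltr_wpDr ?sqr_ge0.
move=> V hV xi t xi0 t0; have [cRe cIm dRe dIm] := hV xi xi0.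
have [h1 h2] := hKC xi xi0.
have Sp := symmetrizer_posdef hS xi0.
have AT : (AS L S xi)^T = AS L S xi := symmetrized_sym Sp (symmetrizer_symA hS xi0).
have Bpsd : possemidefmx (BS L S xi) := symmetrized_psd Sp (symmetrizer_symB hS xi0).
have [[PT _] PP] := sqrtmxP Bpsd.
(* The symmetric part of K A has the same quadratic form as K A. *)
have co x : f xi * dot x x <= dot x (KS xi *m (AS L S xi *m x)) + dot x (BS L S xi *m x).
  have := (hf xi xi0).2 x.
  rewrite qformE !(mulmxDl, mulNmx) mul_scalar_mx /sympart -scalemxAl mulmxDl.
  rewrite !(dotDr, dotNr, dotZr).
  rewrite [dot x (_^T *m x)]dotC dot_mull trmxK -mulmxA; lra.
have dR (s : R) : 0 < s -> is_derive s 1 (fun s => RePart (V xi s))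
    (enorm xi *: (AS L S xi *m ImPart (V xi s)) - BS L S xi *m RePart (V xi s)).
  by move=> s0; rewrite -RePart_fourier_rhs; exact: dRe.
have dI (s : R) : 0 < s -> is_derive s 1 (fun s => ImPart (V xi s))
    (- (enorm xi *: (AS L S xi *m RePart (V xi s))) - BS L S xi *m ImPart (V xi s)).
  by move=> s0; rewrite -ImPart_fourier_rhs; exact: dIm.
have := energy_decay AT PT PP (compensating_skew hKS xi0) (enorm_ge0 xi)
  (f_pos xi xi0) C0 co h1 h2 cRe cIm dR dI t0.
rewrite -!sqr_cnorm => dec.
have cn s : 0 <= cnorm (V xi s) by exact: sqrtr_ge0.
rewrite -(@ler_pXn2r _ 2) ?nnegrE ?mulr_ge0 ?expR_ge0 //.
apply: le_trans dec _.
rewrite !exprMn -expRM_natr ler_wpM2r ?sqr_ge0 //.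
set a := expR _; set b := expR _.
have -> : b = a by congr expR; field; rewrite !lt0r_neq0 // ltr_wpDr ?sqr_ge0.
have := expR_ge0 (- ((1 + C ^+ 2)^-1 * (enorm xi ^+ 2 * f xi / (1 + enorm xi ^+ 2)) / 3) * t).
rewrite -/a; lra.
Qed.
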